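(* Let $(W,S)$ be a Coxeter group of finite rank (i.e. $S$ is finite). There is a constant $M$ (depending on $(W,S)$) such that $|\mathfrak{Q}|\le M$ for any intersecting set $\mathfrak{Q}$.
   Context: Let $m_{st}$ be the order of $st$ ($s,t\in S$). $V$ is the real vector space with basis $\{\alpha_s\mid s\in S\}$ and symmetric bilinear form $\operatorname{B}(\alpha_s,\alpha_t)=-\cos(\pi/m_{st})$ if $m_{st}\neq\infty$ and $-1$ if $m_{st}=\infty$. $W$ acts on $V$ by $sv=v-2\operatorname{B}(\alpha_s,v)\alpha_s$ and on the dual $V^*$ by $\langle wf,wv\rangle=\langle f,v\rangle$. Let $\Phi=\{w\alpha_s\mid w\in W,s\in S\}$ and let $\Phi^+$ be the set of roots that are nonnegative combinations of the $\alpha_s$. For $\alpha\in\Phi$ let $H_\alpha=\{f\in V^*\mid\langle f,\alpha\rangle=0\}$, and let $\mathfrak{P}=\{H_\alpha\mid\alpha\in\Phi^+\}$. Let $C=\{f\in V^*\mid\langle f,\alpha_s\rangle>0\ \forall s\in S\}$, let $\overline{C}$ be its closure, let $U=\bigcup_{w\in W}w\overline{C}$ be the Tits cone and $U^\circ$ its interior in $V^*$. A subset $\mathfrak{Q}\subset\mathfrak{P}$ is called intersecting if $H_1\cap H_2\cap U^\circ\neq\varnothing$ for any $H_1,H_2\in\mathfrak{Q}$ (in particular $\varnothing$ is intersecting). *)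

(* Defs.v *)
From HB Require Import structures.
From mathcomp Require Import all_boot all_order all_algebra.
From mathcomp Require Import all_classical all_reals all_analysis.
From mathcomp Require Import zify ring.
Set Implicit Arguments.
Unset Strict Implicit.
Unset Printing Implicit Defensive.
Import Order.TTheory GRing.Theory Num.Theory.
Import numFieldNormedType.Exports.
Local Open Scope classical_set_scope.
Local Open Scope ring_scope.

(* The value 0 encodes infinite order. *)
Definition gorder (W : groupType) (x : W) : nat :=
  if pselect (exists k, (0 < k)%N && (x ^+ k == 1)%g) is left h
  then ex_minn h else 0%N.

Section GroupOrder.
Variable W : groupType.

Lemma gorderP (x : W) k : (0 < k)%N -> (x ^+ k = 1)%g ->
  [/\ (0 < gorder x)%N, (x ^+ gorder x = 1)%g & (gorder x <= k)%N].
Proof.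
move=> k0 xk; rewrite /gorder; case: pselect => [h|[]]; last first.
  by exists k; rewrite k0 xk eqxx.
case: ex_minnP => m /andP[m0 /eqP xm] mmin; split=> //.
by apply: mmin; rewrite k0 xk eqxx.
Qed.

Lemma expg_gorder (x : W) : (x ^+ gorder x = 1)%g.
Proof.
rewrite /gorder; case: pselect => [h|_] //.
by case: ex_minnP => m /andP[_ /eqP].
Qed.

Lemma gorderV (x : W) : gorder (x^-1)%g = gorder x.
Proof.
have le_order (y z : W) : (forall k, (y ^+ k = 1)%g -> (z ^+ k = 1)%g) ->
    (0 < gorder y)%N -> (0 < gorder z <= gorder y)%N.
  move=> yz y0; have [z0 _ zy] := gorderP y0 (yz _ (expg_gorder y)).
  by rewrite z0 zy.
have xV k : (x ^+ k = 1)%g -> (x^-1 ^+ k = 1)%g.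
  by move=> xk; rewrite expVgn xk invg1.
have Vx k : (x^-1 ^+ k = 1)%g -> (x ^+ k = 1)%g.
  by rewrite expVgn => /eqP; rewrite invg_eq1 => /eqP.
have := le_order _ _ xV; have := le_order _ _ Vx.
case: (gorder x) => [|p]; case: (gorder _) => [|q] //.
- by move=> /(_ isT).
- by move=> _ /(_ isT).
- by move=> /(_ isT) h1 /(_ isT) h2; apply/eqP; rewrite eqn_leq; lia.
Qed.

End GroupOrder.

Definition generates (W : groupType) (I : Type) (s : I -> W) : Prop :=
  forall A : set W,
    A 1%g -> (forall x y, A x -> A y -> A (x * y)%g) ->
    (forall x, A x -> A (x^-1)%g) -> (forall i, A (s i)) -> A = setT.

(* (W, S) is a Coxeter system, where S = {s_0, ..., s_(n-1)} is a finite set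
   of generators of order 2, enumerated without repetition.  The last clause is
   the universal property of the presentation
     < S | (s_i s_j)^m_ij = 1 whenever m_ij is finite >;
   the relation is void for m_ij = 0, i.e., when s_i s_j has infinite order. *)
Definition coxeter_system (W : groupType) (n : nat) (s : 'I_n -> W) : Prop :=
  [/\ injective s,
      forall i, gorder (s i) = 2%N,
      generates s &
      forall (G : groupType) (f : 'I_n -> G),
        (forall i j, ((f i * f j) ^+ gorder (s i * s j) = 1)%g) ->
        exists phi : {multiplicative W -> G}, forall i, phi (s i) = f i].

(* V is the space 'cV[R]_n of column vectors; alpha i is its standard basis. *)
Definition alpha (R : realType) (n : nat) (i : 'I_n) : 'cV[R]_n := delta_mx i 0.

Section GeometricRepresentation.
Variables (R : realType) (W : groupType) (n : nat) (s : 'I_n -> W).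

Definition gram : 'M[R]_n :=
  \matrix_(i, j) (let m := gorder (s i * s j)%g in
                  if m == 0%N then -1 else - cos (pi / m%:R)).

Definition bform (u v : 'cV[R]_n) : R := (u^T *m gram *m v) 0 0.

Definition reflection (i : 'I_n) (v : 'cV[R]_n) : 'cV[R]_n :=
  v - (2 * bform (alpha R i) v) *: alpha R i.

Definition is_geom_rep (rho : W -> 'M[R]_n) : Prop :=
  [/\ rho 1%g = 1%:M,
      forall x y, rho (x * y)%g = rho x *m rho y &
      forall i v, rho (s i) *m v = reflection i v].

(* Existence and uniqueness for a Coxeter system: geom_repP, geom_rep_unique. *)
Definition geom_rep : W -> 'M[R]_n := xget (fun=> 1%:M) [set rho | is_geom_rep rho].

Definition geom_act (w : W) (v : 'cV[R]_n) : 'cV[R]_n := geom_rep w *m v.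

(* The dual V^* is the space 'rV[R]_n of row vectors. *)
Definition pairing (f : 'rV[R]_n) (v : 'cV[R]_n) : R := (f *m v) 0 0.

(* The contragredient action; see pairing_dual_act. *)
Definition dual_act (w : W) (f : 'rV[R]_n) : 'rV[R]_n := f *m geom_rep (w^-1)%g.

Definition coxeter_root : set 'cV[R]_n :=
  [set v | exists (w : W) (i : 'I_n), v = geom_act w (alpha R i)].

Definition pos_root : set 'cV[R]_n :=
  [set v | coxeter_root v /\
     exists c : 'I_n -> R,
       (forall i, 0 <= c i) /\ v = \sum_(i < n) c i *: alpha R i].

Definition hyperplane (v : 'cV[R]_n) : set 'rV[R]_n := [set f | pairing f v = 0].

Definition hyperplanes : set (set 'rV[R]_n) := [set hyperplane v | v in pos_root].

Definition chamber : set 'rV[R]_n :=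
  [set f | forall i, 0 < pairing f (alpha R i)].

Definition tits_cone : set 'rV[R]_n :=
  \bigcup_(w in [set: W]) (dual_act w @` closure chamber).

Definition intersecting (Q : set (set 'rV[R]_n)) : Prop :=
  Q `<=` hyperplanes /\
  forall H1 H2, Q H1 -> Q H2 -> (H1 `&` H2 `&` tits_cone°) !=set0.

End GeometricRepresentation.

Section GeneralLinear.
Variables (R : realType) (n : nat).

Record glmx := GLmx { glval : 'M[R]_n; glvalP : glval \in unitmx }.
HB.instance Definition _ := [isSub for glval].
HB.instance Definition _ := [Choice of glmx by <:].

Fact glone_subproof : (1%:M : 'M[R]_n) \in unitmx. Proof. exact: unitmx1. Qed.
Fact glmul_subproof (A B : glmx) : glval A *m glval B \in unitmx.
Proof. by rewrite unitmx_mul !glvalP. Qed.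
Fact glinv_subproof (A : glmx) : invmx (glval A) \in unitmx.
Proof. by rewrite unitmx_inv glvalP. Qed.

Let glone := GLmx glone_subproof.
Let glmul A B := GLmx (glmul_subproof A B).
Let glinv A := GLmx (glinv_subproof A).

Fact glmulA : associative glmul.
Proof. by move=> A B C; apply: val_inj; rewrite /= mulmxA. Qed.
Fact glmul1 : left_id glone glmul.
Proof. by move=> A; apply: val_inj; rewrite /= mul1mx. Qed.
Fact glmulr1 : right_id glone glmul.
Proof. by move=> A; apply: val_inj; rewrite /= mulmx1. Qed.
Fact glmulV : left_inverse glone glinv glmul.
Proof. by move=> A; apply: val_inj; rewrite /= mulVmx ?glvalP. Qed.
Fact glmulrV : right_inverse glone glinv glmul.
Proof. by move=> A; apply: val_inj; rewrite /= mulmxV ?glvalP. Qed.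

HB.instance Definition _ :=
  isGroup.Build glmx glmulA glmul1 glmulr1 glmulV glmulrV.

End GeneralLinear.

Section GeometricRepresentationTheory.
Variables (R : realType) (W : groupType) (n : nat) (s : 'I_n -> W).

Hypothesis cox : coxeter_system s.

Lemma coxeter_sq i : (s i * s i = 1)%g.
Proof. by case: cox => _ /(_ i) si2 _ _; rewrite -(expg_gorder (s i)) si2. Qed.

Lemma coxeter_inv i : (s i)^-1%g = s i.
Proof. by apply: (@mulgI _ (s i)); rewrite mulgV coxeter_sq. Qed.

Lemma gram_sym i j : gram R s i j = gram R s j i.
Proof. by rewrite !mxE -[(s j * s i)%g]invgK invgM !coxeter_inv gorderV. Qed.

Lemma gram_diag i : gram R s i i = 1.
Proof.
have [ord_gt0 _ ord_le1] := @gorderP W 1%g 1%N isT (expg1n W 1%N).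
have ordE : gorder (1%g : W) = 1%N by apply/eqP; rewrite eqn_leq ord_le1 ord_gt0.
by rewrite mxE coxeter_sq ordE /= divr1 cospi opprK.
Qed.

Lemma bformE i j : bform s (alpha R i) (alpha R j) = gram R s i j.
Proof.
by rewrite /bform /alpha trmx_delta -mulmxA -colE -rowE !mxE.
Qed.

Lemma bformDr (u v w : 'cV[R]_n) : bform s u (v + w) = bform s u v + bform s u w.
Proof. by rewrite /bform mulmxDr mxE. Qed.

Lemma bformZr (u v : 'cV[R]_n) a : bform s u (a *: v) = a * bform s u v.
Proof. by rewrite /bform -scalemxAr mxE. Qed.

Let reflmx (i : 'I_n) : 'M[R]_n :=
  1%:M - 2 *: (alpha R i *m ((alpha R i)^T *m gram R s)).

Lemma reflmxE i (v : 'cV[R]_n) : reflmx i *m v = reflection s i v.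
Proof.
rewrite /reflmx /reflection mulmxBl mul1mx -scalemxAl -mulmxA.
rewrite [X in alpha R i *m X]mx11_scalar mul_mx_scalar scalerA.
by [].
Qed.

Lemma reflectionK i (v : 'cV[R]_n) : reflection s i (reflection s i v) = v.
Proof.
rewrite /reflection -!(scaleNr _ (alpha R i)) bformDr bformZr bformE gram_diag.
rewrite -addrA -scalerDl.
set x := bform _ _ _. have -> : - (2 * x) + - (2 * (x + - (2 * x) * 1)) = 0.
  by ring.
by rewrite scale0r addr0.
Qed.

Lemma mulmx_cV_inj (A B : 'M[R]_n) :
  (forall v : 'cV[R]_n, A *m v = B *m v) -> A = B.
Proof.
move=> AB; apply/matrixP => i j.
by have /matrixP/(_ i 0) := AB (delta_mx j 0); rewrite -!colE !mxE.
Qed.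

Fact reflmx_unit i : reflmx i \in unitmx.
Proof.
have e : reflmx i *m reflmx i = 1%:M.
  apply: mulmx_cV_inj => v.
  by rewrite -mulmxA !reflmxE reflectionK mul1mx.
by case/mulmx1_unit: e.
Qed.

Let g i : glmx R n := GLmx (reflmx_unit i).

(* Closed form for the powers of the product of two reflections: with
   B(alpha_i, alpha_j) = - cos t, the product acts as the rotation of angle
   2 t on the plane spanned by alpha_i and alpha_j. *)
Lemma refl2_iter i j (t : R) k (v : 'cV[R]_n) : gram R s i j = - cos t -> sin t != 0 ->
  let x := bform s (alpha R i) v in let y := bform s (alpha R j) v in
  iter k (reflection s i \o reflection s j) v =
  v + - ((sin t)^-2 *
         ((cos t - (cos (2 * t *+ k) * cos t - sin (2 * t *+ k) * sin t)) * y
          + (1 - cos (2 * t *+ k)) * x)) *: alpha R i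
    + - ((sin t)^-2 *
         ((1 - cos (2 * t *+ k)) * y
          + (cos t - (cos (2 * t *+ k) * cos t + sin (2 * t *+ k) * sin t)) * x))
      *: alpha R j.
Proof.
move=> gij st0 x y.
have gji : gram R s j i = - cos t by rewrite gram_sym.
elim: k => [|k IH].
  rewrite mulr0n cos0 sin0 /= !(mul1r, mul0r, subr0, addr0, subrr).
  by rewrite mulr0 oppr0 !scale0r !addr0.
rewrite iterS IH {IH} /= (mulrSr (2 * t) k) cosD sinD.
set C := cos (2 * t *+ k); set D := sin (2 * t *+ k).
have -> : cos (2 * t) = 2 * cos t ^+ 2 - 1 by rewrite mulr_natl cos_mulr2n mulr_natl.
have -> : sin (2 * t) = 2 * sin t * cos t.
  by rewrite mulr_natl sin_mulr2n; ring.
have c2 : cos t ^+ 2 = 1 - sin t ^+ 2 by rewrite cos2sin2.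
set c := cos t in gij gji c2 *; set d := sin t in st0 c2 *.
rewrite /reflection -!(scaleNr _ (alpha R _)) !(bformDr, bformZr, bformE) -/x -/y.
rewrite gij gji !gram_diag.
set a := alpha R i; set b := alpha R j.
set p := - (d ^- 2 * _); set q := - (d ^- 2 * _).
set p' := - (_ * (_ * y + _)); set q' := - (_ * (_ * y + _)).
have E : forall z w : R, v + p *: a + q *: b + z *: b + w *: a =
  v + (p + w) *: a + (q + z) *: b.
  move=> z w; rewrite !scalerDl -[v + p *: a + q *: b + z *: b]addrA.
  by rewrite [LHS]addrAC !addrA.
rewrite E; congr (_ + _ *: _ + _ *: _); rewrite /p' /q' /p /q {E}.
all: field: c2; exact: st0.
Qed.

Fact reflmx_rel i j : ((g i * g j) ^+ gorder (s i * s j) = 1)%g.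
Proof.
have powE k (v : 'cV[R]_n) : glval ((g i * g j) ^+ k)%g *m v =
    iter k (reflection s i \o reflection s j) v.
  elim: k v => [|k IH] v; first by rewrite mul1mx.
  by rewrite expgS iterS -IH /= -!reflmxE !mulmxA.
apply: val_inj; apply: mulmx_cV_inj => v; rewrite powE mul1mx.
have := expg_gorder (s i * s j)%g.
have : gram R s i j = let m := gorder (s i * s j)%g in
  if m == 0%N then -1 else - cos (pi / m%:R) by rewrite mxE.
case: (gorder _) => [|[|m]] //.
  move=> _; rewrite expg1 => ij1.
  have -> : j = i.
    by case: cox => inj _ _ _; apply: inj;
       apply: (@mulgI _ (s i)); rewrite ij1 coxeter_sq.
  by rewrite /= reflectionK.
pose t : R := pi / m.+2%:R; move=> gij _.
have {}gij : gram R s i j = - cos t by [].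
have pi0 := pi_gt0 R.
have t0 : 0 < t < pi.
  rewrite divr_gt0 //= ltr_pdivrMr // ltr_pMr // ltr1n //.
have st0 : sin t != 0 by rewrite gt_eqF // sin_gt0_pi.
rewrite (refl2_iter _ _ gij st0).
have -> : 2 * t *+ m.+2 = pi *+ 2.
  have : m.+2%:R != 0 :> R by rewrite pnatr_eq0.
  rewrite /t -[LHS]mulr_natr -[pi *+ 2]mulr_natl; move: m.+2%:R => N N0.
  by rewrite mulrA divfK.
rewrite cos2pi sin2pi !(mul1r, mul0r, subr0, addr0, subrr).
by rewrite mulr0 oppr0 !scale0r !addr0.
Qed.

Lemma geom_repP : is_geom_rep s (@geom_rep R W n s).
Proof.
apply: xgetPex; case: cox => _ _ _ /(_ _ _ reflmx_rel)[phi phiE].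
have phi1 : phi 1%g = 1%g.
  by apply: (@mulgI _ (phi 1%g)); rewrite -gmulfM mulg1 mulg1.
exists (fun w => glval (phi w)); split=> [|x y|i v].
- by rewrite phi1.
- by rewrite gmulfM.
- by rewrite phiE reflmxE.
Qed.

Lemma geom_rep_unique (rho : W -> 'M[R]_n) :
  is_geom_rep s rho -> rho = geom_rep R s.
Proof.
move=> [r1 rM rs]; have [g1 gM gs] := geom_repP; case: cox => _ _ gen _.
have {gen} /seteqP[_ allE] : [set w | rho w = geom_rep R s w] = setT.
  apply: gen => [|x y xE yE|x xE|i] /=.
  - by rewrite r1 g1.
  - by rewrite rM gM xE yE.
  - have gV : geom_rep R s (x^-1)%g *m geom_rep R s x = 1%:M by rewrite -gM mulVg.
    have rV : rho x *m rho (x^-1)%g = 1%:M by rewrite -rM mulgV.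
    by rewrite -[LHS]mul1mx -gV -mulmxA -xE rV mulmx1.
  - by apply: mulmx_cV_inj => v; rewrite rs gs.
by apply/funext => w; exact: allE.
Qed.

Lemma geom_act_mul (x y : W) (v : 'cV[R]_n) : geom_act s (x * y)%g v = geom_act s x (geom_act s y v).
Proof. by have [_ gM _] := geom_repP; rewrite /geom_act gM mulmxA. Qed.

Lemma geom_act_gen i (v : 'cV[R]_n) : geom_act s (s i) v = reflection s i v.
Proof. by have [_ _ gs] := geom_repP; rewrite /geom_act gs. Qed.

Lemma pairing_dual_act (w : W) (f : 'rV[R]_n) (v : 'cV[R]_n) :
  pairing (dual_act s w f) (geom_act s w v) = pairing f v.
Proof.
have [g1 gM _] := geom_repP; rewrite /pairing /dual_act /geom_act.
by rewrite -mulmxA [_ *m (_ *m v)]mulmxA -gM mulVg g1 mul1mx.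
Qed.

End GeometricRepresentationTheory.

(* Main.v *)
Require Import Defs.
From mathcomp Require Import all_boot all_order all_algebra.
From mathcomp Require Import all_classical all_reals all_analysis.
From mathcomp Require Import zify ring lra.
Set Implicit Arguments.
Unset Strict Implicit.
Unset Printing Implicit Defensive.
Import Order.TTheory GRing.Theory Num.Theory.
Import numFieldNormedType.Exports.
Local Open Scope classical_set_scope.
Local Open Scope ring_scope.

(* Two walls meeting in the interior of the Tits cone have reflections whose
   product has finite order: the set of roots vanishing at a common interior
   point is finite and stable under both reflections.  On the other hand the
   geometric representation has entries in the ring Z[2 cos (pi / N)], which is
   finite modulo 3 and does not contain 1/3, so, as in Minkowski's lemma, an
   element of finite order that is trivial modulo 3 is trivial.  Colouring a
   wall by its reflection modulo 3 is therefore injective on an intersecting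
   set, because equal colours make the product of two reflections trivial
   modulo 3. *)

Definition nonneg (R : realType) (n : nat) (v : 'cV[R]_n) : Prop :=
  forall i, 0 <= v i 0.

(** Conjugation by [p] turns [p * q] into [q * p], its inverse. *)
Lemma involutions_conjX (G : groupType) (p q : G) k :
  (p * p = 1)%g -> (q * q = 1)%g -> (p * (p * q) ^+ k * p = (p * q) ^- k)%g.
Proof.
move=> pp qq; have inv x : (x * x = 1)%g -> (x^-1 = x :> G)%g.
  by move=> xx; apply: (@mulgI _ x); rewrite mulgV.
rewrite -expVgn invgM (inv _ pp) (inv _ qq).
elim: k => [|k IH]; first by rewrite !expg0 mulg1.
by rewrite expgSr mulgA [(p * _ * (p * q))%g]mulgA IH expgSr -!mulgA.
Qed.

(** * Words, length and alternating products of generators *)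

Section Words.
Variables (W : groupType) (n : nat) (s : 'I_n -> W).
Hypothesis cox : coxeter_system s.

Fixpoint wprod (l : seq 'I_n) : W :=
  if l is i :: l' then (s i * wprod l')%g else 1%g.

Lemma wprod_cat l1 l2 : wprod (l1 ++ l2) = (wprod l1 * wprod l2)%g.
Proof. by elim: l1 => [|i l IH] /=; rewrite ?mul1g // IH mulgA. Qed.

Lemma wprod_rcons l i : wprod (rcons l i) = (wprod l * s i)%g.
Proof. by rewrite -cats1 wprod_cat /= mulg1. Qed.

Lemma wprod_surj w : exists l, wprod l = w.
Proof.
case: cox => _ _ gen _.
suff /seteqP[_ /(_ w)] : [set w | exists l, wprod l = w] = setT by apply.
apply: gen => /=.
- by exists [::].
- by move=> _ _ [l <-] [l' <-]; exists (l ++ l'); rewrite wprod_cat.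
- move=> _ [l <-]; exists (rev l); elim: l => [|i l IH] /=.
    by rewrite invg1.
  by rewrite rev_cons wprod_rcons IH invgM (coxeter_inv cox).
- by move=> i; exists [:: i]; rewrite /= mulg1.
Qed.

Lemma wprod_size_ex w : exists k, `[< exists2 l, size l = k & wprod l = w >].
Proof. by case: (wprod_surj w) => l lw; exists (size l); apply/asboolP; exists l. Qed.

Definition len (w : W) : nat := ex_minn (wprod_size_ex w).

Lemma lenP w : exists2 l, size l = len w & wprod l = w.
Proof. by rewrite /len; case: ex_minnP => k /asboolP[l lk lw] _; exists l. Qed.

Lemma len_wprod l : (len (wprod l) <= size l)%N.
Proof.
rewrite /len; case: ex_minnP => k _; apply; apply/asboolP; by exists l.
Qed.

Lemma len_mul x y : (len (x * y)%g <= len x + len y)%N.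
Proof.
case: (lenP x) (lenP y) => [l1 <- <-] [l2 <- <-].
by rewrite -wprod_cat -size_cat len_wprod.
Qed.

Lemma mulg_genK i w : (w * s i * s i)%g = w.
Proof. by rewrite -mulgA (coxeter_sq cox) mulg1. Qed.

(* The alternating product of [k] generators among [s a] and [s b] whose last
   factor is [s a]. *)
Fixpoint alt (a b : 'I_n) (k : nat) : W :=
  if k is k'.+1 then (alt b a k' * s a)%g else 1%g.

Lemma alt_word a b k :
  exists l, [/\ all (pred2 a b) l, size l = k & wprod l = alt a b k].
Proof.
elim: k a b => [|k IH] a b; first by exists [::].
have [l [lab lk lE]] := IH b a; exists (rcons l a); split.
- rewrite all_rcons /= eqxx /=; apply: sub_all lab => x /=; by rewrite orbC.
- by rewrite size_rcons lk.
- by rewrite wprod_rcons lE.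
Qed.

Lemma alt_split a b k m : exists l,
  [/\ all (pred2 a b) l, size l = k & alt a b (k + m) = (wprod l * alt a b m)%g].
Proof.
elim: m a b => [|m IH] a b.
  by have [l [? ? ?]] := alt_word a b k; exists l; rewrite addn0 /= mulg1.
have [l [lab lk lE]] := IH b a; exists l; split=> //.
  by apply: sub_all lab => x /=; rewrite orbC.
by rewrite addnS /= lE mulgA.
Qed.

(** A further letter extends the alternation or, the generators being involutions, cancels its last
    factor. *)
Lemma word_alt a b l : all (pred2 a b) l ->
  exists2 k, (k <= size l)%N & wprod l = alt a b k \/ wprod l = alt b a k.
Proof.
elim/last_ind: l => [|l x IH]; first by exists 0%N => //; left.
rewrite all_rcons => /andP[/= xab /IH[k kl lE]].
rewrite size_rcons wprod_rcons.
have key c d : x = c \/ x = d -> exists2 k0, (k0 <= (size l).+1)%N &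
    (alt c d k * s x)%g = alt c d k0 \/ (alt c d k * s x)%g = alt d c k0.
  case=> ->; last by exists k.+1 => //; right.
  case: k {lE} kl => [|k] kl; first by exists 1%N => //; left; rewrite /= !mul1g.
  by exists k; [lia | right; rewrite /= mulg_genK].
have [xa xb] : (x = a \/ x = b) /\ (x = b \/ x = a).
  by case/orP: xab => /eqP ->; split; [left|right|right|left].
case: lE => ->; first exact: key.
by have [k0 k0l E] := key b a xb; exists k0 => //; case: E; [right|left].
Qed.

(** For [k] the order of [s b * s a] this becomes the braid relation [alt_braid]. *)
Lemma alt_expg a b k : (alt b a k * (s b * s a) ^+ k)%g = alt a b k.
Proof.
elim: k => [|k IH]; first by rewrite expg0 mulg1.
have conj : (s b * (s b * s a) ^+ k.+1 = (s b * s a) ^- k.+1 * s b)%g.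
  by rewrite -involutions_conjX ?(coxeter_sq cox) // mulg_genK.
rewrite /= -mulgA conj expgS invgM -{1}IH -!mulgA.
rewrite [((_ * _) ^+ k * (_ * _))%g]mulgA mulgV mul1g.
by rewrite invgM !(coxeter_inv cox) -mulgA (coxeter_sq cox) mulg1.
Qed.

End Words.

(** * Congruence modulo 3 in Z[x] and Minkowski's lemma *)

Section IntegerAdjoin.
Variables (R : numFieldType) (x : R).

Definition int_adjoin : set R :=
  [set y | exists p : {poly int}, y = (map_poly intr p).[x]].

Lemma int_adjoin_int (k : int) : int_adjoin k%:~R.
Proof. by exists k%:P; rewrite map_polyC hornerC. Qed.

Lemma int_adjoinD y z : int_adjoin y -> int_adjoin z -> int_adjoin (y + z).
Proof. by move=> [p ->] [q ->]; exists (p + q); rewrite rmorphD hornerD. Qed.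

Lemma int_adjoinM y z : int_adjoin y -> int_adjoin z -> int_adjoin (y * z).
Proof. by move=> [p ->] [q ->]; exists (p * q); rewrite rmorphM hornerM. Qed.

Lemma int_adjoinN y : int_adjoin y -> int_adjoin (- y).
Proof. by move=> [p ->]; exists (- p); rewrite rmorphN hornerN. Qed.

Lemma int_adjoin_nat (k : nat) : int_adjoin k%:R.
Proof. exact: (int_adjoin_int k). Qed.

Lemma int_adjoinMn y k : int_adjoin y -> int_adjoin (y *+ k).
Proof. by move=> yx; rewrite -mulr_natr; apply: int_adjoinM (int_adjoin_nat k). Qed.

Lemma int_adjoin_sum (I : Type) (r : seq I) (P : pred I) (F : I -> R) :
  (forall i, int_adjoin (F i)) -> int_adjoin (\sum_(i <- r | P i) F i).
Proof.
move=> Fx; apply: (big_ind int_adjoin) => //; first exact: (int_adjoin_nat 0).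
exact: int_adjoinD.
Qed.

(** Membership in Z[x] is built in because compatibility with products relies on it. *)
Definition cong3 (y z : R) : Prop :=
  [/\ int_adjoin y, int_adjoin z & exists2 u, int_adjoin u & y = z + u *+ 3].

Lemma cong3_refl y : int_adjoin y -> cong3 y y.
Proof. by split=> //; exists 0; [exact: (int_adjoin_nat 0) | rewrite mul0rn addr0]. Qed.

Lemma cong3D y y' z z' : cong3 y y' -> cong3 z z' -> cong3 (y + z) (y' + z').
Proof.
move=> [yx y'x [u ux ->]] [zx z'x [v vx ->]]; split; try exact: int_adjoinD.
  by do 2![apply: int_adjoinD => //]; exact: int_adjoinMn.
by exists (u + v); [exact: int_adjoinD | ring].
Qed.

Lemma cong3M y y' z z' : cong3 y y' -> cong3 z z' -> cong3 (y * z) (y' * z').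
Proof.
move=> [yx y'x [u ux yE]] [zx z'x [v vx zE]]; split; try exact: int_adjoinM.
exists (u * z + y' * v); last by rewrite yE zE; ring.
by apply: int_adjoinD; exact: int_adjoinM.
Qed.

Lemma cong3_det n (A B : 'M[R]_n) :
  (forall i j, cong3 (A i j) (B i j)) -> cong3 (\det A) (\det B).
Proof.
move=> AB; rewrite /determinant.
apply: (big_ind2 cong3) => [|????|s _].
- exact/cong3_refl/(int_adjoin_nat 0).
- exact: cong3D.
apply: cong3M.
  apply/cong3_refl; rewrite -signr_odd; case: odd; rewrite ?expr1 ?expr0.
    exact: (int_adjoin_int (-1)).
  exact: (int_adjoin_nat 1).
apply: (big_ind2 cong3) => [|????|i _] //.
  exact/cong3_refl/(int_adjoin_nat 1).
exact: cong3M.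
Qed.

Definition mx_adjoin n (A : 'M[R]_n) : Prop := forall i j, int_adjoin (A i j).

Lemma mx_adjoin1 n : mx_adjoin (1 : 'M[R]_n).
Proof. by move=> i j; rewrite !mxE; exact: int_adjoin_nat. Qed.

Lemma mx_adjoinD n (A B : 'M[R]_n) : mx_adjoin A -> mx_adjoin B -> mx_adjoin (A + B).
Proof. by move=> Ax Bx i j; rewrite mxE; exact: int_adjoinD. Qed.

Lemma mx_adjoinM n (A B : 'M[R]_n) : mx_adjoin A -> mx_adjoin B -> mx_adjoin (A * B).
Proof. by move=> Ax Bx i j; rewrite mxE; apply: int_adjoin_sum => k; exact: int_adjoinM. Qed.

Lemma mx_adjoinMn n (A : 'M[R]_n) k : mx_adjoin A -> mx_adjoin (A *+ k).
Proof. by move=> Ax i j; rewrite mulmxnE; exact: int_adjoinMn. Qed.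

Hypothesis xint : integralOver (intr : int -> R) x.

(** Integrality of [x] makes [y] a root of a monic integer polynomial, of degree [d] say. Multiplied
    by [3 ^+ d], its equation writes [q ^+ d] as a sum of multiples of 3. *)
Lemma dvd3_int_adjoin y q : int_adjoin y -> q%:R = y *+ 3 -> (3 %| q)%N.
Proof.
move=> [g yE] qE.
have [p pmon py] : integralOver (intr : int -> R) y.
  rewrite yE; apply: integral_horner => //.
  apply/integral_poly => i; rewrite coef_map; exact: integral_id.
have p0 := monic_neq0 pmon.
have psz : size p = (size p).-1.+1 by rewrite prednK // size_poly_gt0.
set d := (size p).-1 in psz.
have pd : p`_d = 1 by exact/eqP.
have /eqP : (\sum_(i < d.+1) p`_i * (3 ^+ (d - i) * q%:Z ^+ i))%:~R = 0 :> R.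
  have szp : (size (map_poly (intr : int -> R) p) <= d.+1)%N by rewrite -psz size_poly.
  transitivity (3 ^+ d * (map_poly (intr : int -> R) p).[y]).
    rewrite rmorph_sum (horner_coef_wide _ szp) mulr_sumr.
    apply: eq_bigr => i _; rewrite !rmorphM !rmorphXn /= coef_map /=.
    have -> : 3 ^+ d = 3 ^+ (d - i) * 3 ^+ i :> R by rewrite -exprD subnK ?leq_ord.
    by rewrite -pmulrn qE -[y *+ 3]mulr_natr exprMn; ring.
  by rewrite (eqP py) mulr0.
rewrite intr_eq0 big_ord_recr /= subnn expr0 mul1r pd mul1r addr_eq0 => /eqP sE.
have : (3 %| q%:Z ^+ d)%Z.
  rewrite -[_ ^+ d]opprK -sE rpredN; apply: rpred_sum => i _.
  by rewrite -(prednK (n := d - i)) ?subn_gt0 // exprS mulrCA -mulrA dvdz_mulr.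
rewrite dvdzE abszX /= Euclid_dvdX // => /andP[] //.
Qed.

(** Modulo 3 the determinant of [q%:R + B *+ 3] is [q ^ n]. If it vanished, [dvd3_int_adjoin] would
    make 3 divide [q]; so this factor is invertible. *)
Lemma mx_adjoin_cancel n (A B : 'M[R]_n) q : ~~ (3 %| q)%N -> mx_adjoin B ->
  (q%:R + B *+ 3) * A = 0 -> A = 0.
Proof.
move=> q3 Bx.
have : cong3 (\det ((q%:R : 'M[R]_n) + B *+ 3)) (\det (q%:R : 'M[R]_n)).
  have qx : mx_adjoin (q%:R : 'M[R]_n) by apply: mx_adjoinMn; exact: mx_adjoin1.
  apply: cong3_det => i j; split.
  - by apply: mx_adjoinD => //; exact: mx_adjoinMn.
  - exact: qx.
  - by exists (B i j) => //; rewrite mxE mulmxnE.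
move=> [_ _ [u ux detE]].
have unit : (q%:R : 'M[R]_n) + B *+ 3 \in unitmx.
  rewrite unitmxE unitfE; apply: contra q3 => /eqP det0.
  have : (3 %| q ^ n)%N; last by rewrite Euclid_dvdX // => /andP[].
  apply: (@dvd3_int_adjoin (- u)); first exact: int_adjoinN.
  move/eqP: detE; rewrite det0 eq_sym addr_eq0 mulNrn => /eqP <-.
  by rewrite -[q%:R in RHS]scaler_nat scalemx1 det_scalar natrX.
by move=> /(congr1 (mulmx (invmx (q%:R + B *+ 3)))); rewrite mulKmx // mulmx0.
Qed.

(** Binomial terms beyond the linear one carry a further factor 3. They are collected in a left
    factor [T] of [A], with recursion [T' = 1 + T * (1 + A *+ 3)], which is the shape that
    [mx_adjoin_cancel] removes. *)
Lemma expr_1D3 n (A : 'M[R]_n) q : mx_adjoin A ->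
  exists2 C, mx_adjoin C & (1 + A *+ 3) ^+ q = 1 + (q%:R + C *+ 3) * A *+ 3.
Proof.
move=> Ax; elim: q => [|q [C Cx IH]].
  exists 0; first by move=> i j; rewrite mxE; exact: (int_adjoin_nat 0).
  by rewrite expr0 mulr0n mul0rn addr0 mul0r mul0rn addr0.
set T := q%:R + C *+ 3 in IH.
exists (C + T * A).
  apply: mx_adjoinD => //; apply: mx_adjoinM => //; apply: mx_adjoinD.
    exact/mx_adjoinMn/mx_adjoin1.
  exact: mx_adjoinMn.
have -> : q.+1%:R + (C + T * A) *+ 3 = 1 + T * (1 + A *+ 3).
  by rewrite -addn1 natrD mulrDr mulr1 mulrnDl /T mulrnAr -!addrA addrCA.
rewrite exprSr IH mulrDl mul1r [(1 + T * _) * A]mulrDl mul1r mulrnDl -addrA.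
congr (_ + (_ + _)).
rewrite mulrnAl -!mulrA; congr (_ * _ *+ _).
by rewrite mulrDr mulrDl mulr1 mul1r mulrnAl mulrnAr.
Qed.

(* Minkowski's lemma: [(1 + 3A)^q - 1 = 3 (q + 3C) A], and [q + 3C] is invertible
   when 3 does not divide [q]. *)
Lemma torsion_cong3 n (A : 'M[R]_n) m : (0 < m)%N -> mx_adjoin A ->
  (1 + A *+ 3) ^+ m = 1 -> A = 0.
Proof.
have char0 (M : 'M[R]_n) : M *+ 3 = 0 -> M = 0.
  rewrite -scaler_nat => /eqP; rewrite scaler_eq0 pnatr_eq0 /= => /eqP; exact.
(* Exponent 3 is treated directly: the cube is [1 + 9 (1 + 3 (B + B^2)) B], whose inner factor has
   constant term 1, prime to 3. *)
have cube (B : 'M[R]_n) : mx_adjoin B -> (1 + B *+ 3) ^+ 3 = 1 -> B = 0.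
  move=> Bx E; apply: (@mx_adjoin_cancel _ _ (B + B * B) 1) => //.
    by apply: mx_adjoinD => //; exact: mx_adjoinM.
  apply/char0/char0/(addrI 1); rewrite addr0 -[RHS]E !exprSr expr0 mul1r.
  rewrite !(mulrDl, mulrDr, mul1r, mulr1, mulrnAl, mulrnAr) -!mulrA ?mulr1n ?mul1r.
  move: (1 : 'M[R]_n) (B * (B * B)) (B * B) => I B3 B2.
  by apply/matrixP => i j; rewrite !(mxE, mulmxnE); ring.
have [k] := ubnP m; elim: k m A => // k IH m A mk m0 Ax E.
have [m3|m3] := boolP (3 %| m)%N; last first.
  have [C Cx CE] := expr_1D3 m Ax; rewrite CE in E.
  apply: (mx_adjoin_cancel m3 Cx); apply: char0.
  by apply: (addrI 1); rewrite addr0.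
(* The power with exponent [m %/ 3] again has the form 1 + 3A' and its cube is 1. By [cube] it is 1
   itself, so the induction applies to [m %/ 3]. *)
have mE : m = (m %/ 3 * 3)%N by rewrite divnK.
have [C Cx CE] := expr_1D3 (m %/ 3) Ax.
apply: (IH (m %/ 3)%N) => //; [lia | lia | rewrite CE].
rewrite mE exprM CE in E; rewrite (cube _ _ E) ?mul0rn ?addr0 //.
by apply: mx_adjoinM => //; apply: mx_adjoinD; [exact/mx_adjoinMn/mx_adjoin1 | exact: mx_adjoinMn].
Qed.

End IntegerAdjoin.

(** * Invariance of the form and the sign of roots *)

Section Positivity.
Variables (R : realType) (W : groupType) (n : nat) (s : 'I_n -> W).
Hypothesis cox : coxeter_system s.

Local Notation rho := (geom_rep R s).
Local Notation B := (bform s).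
Local Notation a := (alpha R).
Local Notation len := (len cox).

Lemma geom_rep1 : rho 1%g = 1%:M. Proof. by case: (geom_repP R cox). Qed.

Lemma geom_repM x y : rho (x * y)%g = rho x *m rho y.
Proof. by case: (geom_repP R cox). Qed.

Lemma geom_rep_gen i v : rho (s i) *m v = reflection s i v.
Proof. by case: (geom_repP R cox). Qed.

Lemma geom_repK w (v : 'cV[R]_n) : rho w^-1%g *m (rho w *m v) = v.
Proof. by rewrite mulmxA -geom_repM mulVg geom_rep1 mul1mx. Qed.

Lemma geom_repVK w (v : 'cV[R]_n) : rho w *m (rho w^-1%g *m v) = v.
Proof. by rewrite mulmxA -geom_repM mulgV geom_rep1 mul1mx. Qed.

Lemma bformC (u v : 'cV[R]_n) : B u v = B v u.
Proof.
have gT : (gram R s)^T = gram R s.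
  by apply/matrixP => i j; rewrite mxE (gram_sym R cox).
have tr1 (M : 'M[R]_1) : M 0 0 = M^T 0 0 by rewrite mxE.
by rewrite /bform [LHS]tr1 !trmx_mul trmxK gT mulmxA.
Qed.

Lemma bformDl (u v w : 'cV[R]_n) : B (u + v) w = B u w + B v w.
Proof. by rewrite bformC bformDr !(bformC w). Qed.

Lemma bformZl (u v : 'cV[R]_n) c : B (c *: u) v = c * B u v.
Proof. by rewrite bformC bformZr bformC. Qed.

Lemma bform_geom_rep w (u v : 'cV[R]_n) : B (rho w *m u) (rho w *m v) = B u v.
Proof.
case: cox => _ _ gen _.
suff /seteqP[_ /(_ w)] : [set w | forall u v : 'cV[R]_n,
  B (rho w *m u) (rho w *m v) = B u v] = setT by apply.
apply: gen => /= [|x y xE yE|x xE|i] {}u {}v.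
- by rewrite geom_rep1 !mul1mx.
- by rewrite geom_repM -!mulmxA xE yE.
- by rewrite -xE !geom_repVK.
- rewrite !geom_rep_gen /reflection -!(scaleNr _ (alpha R i)) !(bformDl, bformDr, bformZl, bformZr).
  rewrite bformE (gram_diag R cox) (bformC u (alpha R i)).
  ring.
Qed.

Lemma geom_rep_reflection w i (v : 'cV[R]_n) : rho (w * s i * w^-1)%g *m v =
  v - (2 * B (rho w *m a i) v) *: (rho w *m a i).
Proof.
rewrite !geom_repM -!mulmxA geom_rep_gen /reflection mulmxBr geom_repVK -scalemxAr.
by rewrite -{1}(bform_geom_rep w) geom_repVK.
Qed.

Lemma coxeter_order_neq1 i j : i != j -> gorder (s i * s j)%g != 1%N.
Proof.
move=> ij; apply/eqP => o1; have := expg_gorder (s i * s j)%g.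
rewrite o1 expg1 => ij1; move/eqP: ij; apply.
case: cox => inj _ _ _; apply: inj; apply: (@mulgI _ (s i)).
by rewrite ij1 (coxeter_sq cox).
Qed.

(* The Chebyshev-type coefficients of the images of [a i] under alternating
   products: [sin (k t) / sin t] with [t = pi / m], or [k] if [m] is infinite. *)
Lemma dihedral_coef i j : i != j -> exists x : nat -> R,
  [/\ x 0%N = 0, x 1%N = 1,
      forall k, x k.+2 = - (2 * gram R s i j) * x k.+1 - x k &
      forall k, gorder (s i * s j)%g = 0%N \/ (k <= gorder (s i * s j)%g)%N -> 0 <= x k].
Proof.
move=> /coxeter_order_neq1.
have : gram R s i j = let m := gorder (s i * s j)%g in
  if m == 0%N then -1 else - cos (pi / m%:R) by rewrite mxE.
case: (gorder _) => [|[|m]] //= gij _.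
  exists (fun k => k%:R); split=> // k.
  rewrite gij -[k.+2]addn2 -[k.+1]addn1 !natrD; ring.
pose t : R := pi / m.+2%:R.
have {}gij : gram R s i j = - cos t by [].
have pi0 := pi_gt0 R.
have t0 : 0 < t < pi by rewrite divr_gt0 //= ltr_pdivrMr // ltr_pMr // ltr1n.
have st0 : 0 < sin t by rewrite sin_gt0_pi.
exists (fun k => sin (t *+ k) / sin t); split.
- by rewrite mulr0n sin0 mul0r.
- by rewrite mulr1n divff // gt_eqF.
- move=> k; rewrite gij mulrN opprK !mulrA -mulrBl; congr (_ / _).
  set u := t *+ k.+1.
  have -> : t *+ k.+2 = u + t by rewrite mulrSr.
  have -> : t *+ k = u - t by rewrite /u mulrSr addrK.
  rewrite sinD sinB; ring.
- move=> k [//|km]; apply: divr_ge0; last exact: ltW.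
  apply: sin_ge0_pi; apply/andP; split.
    by rewrite mulrn_wge0 // ltW //; case/andP: t0.
  by rewrite -mulr_natr /t mulrAC ler_pdivrMr // ler_pM2l // ler_nat.
Qed.

(** By the recurrence, [s i] sends [x l.+1 *: a j + x l *: a i] to [x l.+2 *: a i + x l.+1 *: a j].
    Each factor thus raises [l] by one and swaps [i] and [j]. *)
Lemma geom_rep_alt i j (x : nat -> R) k l :
  (forall k, x k.+2 = - (2 * gram R s i j) * x k.+1 - x k) ->
  (forall m, (m <= l + k.+1)%N -> 0 <= x m) ->
  exists p q : R, [/\ 0 <= p, 0 <= q &
    rho (alt s i j k) *m (x l.+1 *: a j + x l *: a i) = p *: a j + q *: a i].
Proof.
elim: k l i j => [|k IH] l i j xE x0.
  by exists (x l.+1), (x l); rewrite geom_rep1 mul1mx !x0 //; lia.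
have [m|m mk|p [q [p0 q0 E]]] := IH l.+1 j i.
- by rewrite (gram_sym R cox).
- by apply: x0; lia.
exists q, p; split=> //; rewrite [RHS]addrC -E /= geom_repM -mulmxA geom_rep_gen; congr (_ *m _).
rewrite /reflection !(bformDr, bformZr, bformE) (gram_diag R cox) xE.
rewrite -addrA addrC -scalerBl; congr (_ *: _ + _); ring.
Qed.

Lemma alt_braid i j : alt s i j (gorder (s i * s j)%g) = alt s j i (gorder (s i * s j)%g).
Proof. by rewrite -(alt_expg cox j i) expg_gorder mulg1. Qed.

(* If [u] is a shortest expression in [s i, s j] of its element and does not get
   shorter on multiplication by [s i], it is alternating, ends in [s j] and is
   shorter than the longest element of the dihedral group. *)
Lemma dihedral_nonneg i j u : i != j -> all (pred2 i j) u ->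
  (forall u', all (pred2 i j) u' -> wprod s u' = wprod s u -> (size u <= size u')%N) ->
  (forall u', all (pred2 i j) u' -> wprod s u' = (wprod s u * s i)%g ->
    (size u <= size u')%N) ->
  exists p q : R, [/\ 0 <= p, 0 <= q &
    rho (wprod s u) *m a i = p *: a i + q *: a j].
Proof.
move=> ij uij umin uimin.
have ji_ij l : all (pred2 j i) l -> all (pred2 i j) l.
  by apply: sub_all => z /=; rewrite orbC.
have [k ku uE] := word_alt cox uij.
have {}ku : k = size u.
  apply/eqP; rewrite eqn_leq ku /=.
  case: uE => uE.
    by have [l [lij lk lE]] := alt_word s i j k; rewrite -lk umin ?lE.
  by have [l [/ji_ij lij lk lE]] := alt_word s j i k; rewrite -lk umin ?lE.
have {}uE : wprod s u = alt s j i k.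
  case: uE => // uE; case: k => [|k] in ku uE *; first by rewrite uE.
  have [l [/ji_ij lij lk lE]] := alt_word s j i k.
  have := uimin l lij; rewrite uE lE /= (mulg_genK cox) => /(_ erefl).
  by rewrite lk -ku ltnn.
(* Otherwise the braid relation rewrites the end of the product so that its last factor is [s i],
   and multiplication by [s i] shortens it. *)
have km : gorder (s i * s j)%g = 0%N \/ (k < gorder (s i * s j)%g)%N.
  have [mk|] := leqP (gorder (s i * s j)%g) k; last by right.
  move: (coxeter_order_neq1 ij) (alt_braid i j).
  case: (gorder _) mk => [|m] mk; [by left | move=> _ br].
  have [l [/ji_ij lij lk lE]] := alt_split s j i (k - m.+1) m.+1.
  have [l' [/ji_ij lij' lk' lE']] := alt_word s j i m.
  have := uimin (l ++ l'); rewrite all_cat lij lij' size_cat lk lk' => /(_ isT).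
  rewrite wprod_cat uE -{1}(subnK mk) lE -br /= mulgA (mulg_genK cox) lE'.
  by move=> /(_ erefl); rewrite -ku; lia.
have [x [x0 x1 xE xge0]] := dihedral_coef ij.
(* At index 0 the starting vector [x 1 *: a i + x 0 *: a j] is [a i]. Coefficients are needed up to
   index [k.+1], which [km] still allows. *)
have [|m mk|p [q [p0 q0 E]]] := @geom_rep_alt j i x k 0%N.
- by move=> m; rewrite (gram_sym R cox) xE.
- by apply: xge0; lia.
exists p, q; split=> //; rewrite uE -E x0 x1 scale1r scale0r addr0 //.
Qed.

Lemma nonneg_alpha (i : 'I_n) : nonneg (a i).
Proof. by move=> j; rewrite mxE; case: eqP. Qed.

(* Tits' argument: write [w = v u] with [u] a word in two generators that is as
   long as possible subject to [len w = len v + size u]. *)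
Lemma len_nonneg w i : (len w <= len (w * s i)%g)%N -> nonneg (rho w *m a i).
Proof.
have [k] := ubnP (len w); elim: k w i => // k IH w i wk lei.
have [l lw wE] := lenP cox w.
case/lastP: l => [|l j] in lw wE *.
  by rewrite -wE geom_rep1 mul1mx; exact: nonneg_alpha.
rewrite wprod_rcons in wE; rewrite size_rcons in lw.
have lwj : (len (w * s j)%g < len w)%N.
  by rewrite -wE (mulg_genK cox) wE -lw ltnS len_wprod.
have ij : i != j by apply: contraTneq lwj => <-; rewrite -leqNgt.
pose P m := `[< exists v u, [/\ all (pred2 i j) u, size u = m,
  w = (v * wprod s u)%g & (len v + m = len w)%N] >].
(* This makes the maximal [m] positive, so that [v] is shorter than [w] and the induction applies to
   it. *)
have P1 : P 1%N.
  apply/asboolP; exists (w * s j)%g, [:: j]; split=> //=.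
  - by rewrite eqxx orbT.
  - by rewrite mulg1 (mulg_genK cox).
  - apply/eqP; rewrite addn1 eqn_leq lwj /= -[X in (len X <= _)%N](mulg_genK cox j).
    apply: leq_trans (len_mul cox _ _) _; rewrite -addn1 leq_add2l.
    by rewrite -[s j]mulg1; exact: (len_wprod cox [:: j]).
have Pb m : P m -> (m <= len w)%N.
  by move/asboolP => [v [u [_ _ _ <-]]]; rewrite leq_addl.
have [m /asboolP[v [u [uij um wvu lvm]]] mmax] := ex_maxnP (ex_intro P _ P1) Pb.
have m0 : (0 < m)%N := mmax _ P1.
(* A letter shortening [v] could be moved to the front of [u], against the maximality of [m]. *)
have up x : x \in pred2 i j -> (len v <= len (v * s x)%g)%N.
  move=> xij; rewrite leqNgt; apply/negP => vx.
  suff /mmax : P m.+1 by rewrite ltnn.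
  apply/asboolP; exists (v * s x)%g, (x :: u).
  have wE' : w = (v * s x * wprod s (x :: u))%g by rewrite /= mulgA (mulg_genK cox).
  split=> //=; [exact/andP | by rewrite um | apply/eqP; rewrite eqn_leq; apply/andP; split].
    by rewrite -lvm addnS; lia.
  rewrite {1}wE'; apply: leq_trans (len_mul cox _ _) _.
  by rewrite leq_add2l -um; exact: (len_wprod cox (x :: u)).
have vk : (len v < k)%N by lia.
have vi : nonneg (rho v *m a i) by apply: IH => //; apply: up; rewrite inE eqxx.
have vj : nonneg (rho v *m a j) by apply: IH => //; apply: up; rewrite inE eqxx orbT.
(* A word [u'] shorter than [u] would put the length of [w], or of [w * s i], below [len w]. *)
have [u' _ u'E|u' _ u'E|p [q [p0 q0 E]]] := dihedral_nonneg ij uij.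
- have : (len w <= len v + size u')%N; last by lia.
  rewrite wvu -u'E; apply: leq_trans (len_mul cox _ _) _.
  by rewrite leq_add2l len_wprod.
- have : (len (w * s i)%g <= len v + size u')%N; last by lia.
  rewrite wvu -mulgA -u'E; apply: leq_trans (len_mul cox _ _) _.
  by rewrite leq_add2l len_wprod.
rewrite wvu geom_repM -mulmxA E mulmxDr -!scalemxAr => x.
by move: (vi x) (vj x); rewrite !mxE => vix vjx; rewrite addr_ge0 // mulr_ge0.
Qed.

(** If [s i] shortens [w], then [len_nonneg] applies to [w * s i], which sends [a i] to
    [- (rho w *m a i)]. *)
Lemma geom_rep_alpha_sign w i : nonneg (rho w *m a i) \/ nonneg (- (rho w *m a i)).
Proof.
have [|lwi] := leqP (len w) (len (w * s i)%g); first by left; exact: len_nonneg.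
right; have := @len_nonneg (w * s i)%g i; rewrite (mulg_genK cox) => /(_ (ltnW lwi)).
rewrite geom_repM -mulmxA geom_rep_gen /reflection bformE (gram_diag R cox).
by rewrite mulr1 mulmxBr -scalemxAr scaler_nat mulr2n opprD addNKr.
Qed.

End Positivity.

(** * Inversions, the Tits cone and products of two wall reflections *)

Lemma finite_set_recurrent (T : Type) (u : nat -> T) (A : set T) :
  finite_set A -> (forall k, A (u k)) -> exists a b, (a < b)%N /\ u a = u b.
Proof.
move=> finA uA; have [//|none] := pselect (exists a b, (a < b)%N /\ u a = u b).
case: infinite_nat; have -> : [set: nat] = u @^-1` A.
  by apply/seteqP; split => // k _; exact: uA.
apply: finite_preimage finA => a b _ _ uab.
by case: (ltngtP a b) => // ab; case: none; [exists a, b | exists b, a].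
Qed.

Section Walls.
Variables (R : realType) (W : groupType) (n : nat) (s : 'I_n -> W).
Hypothesis cox : coxeter_system s.

Local Notation rho := (geom_rep R s).
Local Notation B := (bform s).
Local Notation a := (alpha R).
Local Notation root := (@coxeter_root R W n s).

Lemma root_sign (v : 'cV[R]_n) : root v -> nonneg v \/ nonneg (- v).
Proof. by move=> [w [i ->]]; exact: geom_rep_alpha_sign. Qed.

Lemma root_norm (v : 'cV[R]_n) : root v -> B v v = 1.
Proof.
by move=> [w [i ->]]; rewrite bform_geom_rep // bformE (gram_diag R cox).
Qed.

Lemma root_neq0 (v : 'cV[R]_n) : root v -> v != 0.
Proof.
move/root_norm; apply: contra_eq_neq => ->.
by rewrite /bform mulmx0 mxE eq_sym oner_eq0.
Qed.

Lemma root_geom_rep w (v : 'cV[R]_n) : root v -> root (rho w *m v).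
Proof.
by move=> [x [i ->]]; exists (w * x)%g, i; rewrite /geom_act geom_repM // mulmxA.
Qed.

Lemma reflection_alpha i : reflection s i (a i) = - a i.
Proof.
by rewrite /reflection bformE (gram_diag R cox) mulr1 scaler_nat mulr2n opprD addNKr.
Qed.

Lemma root_opp (v : 'cV[R]_n) : root v -> root (- v).
Proof.
move=> [w [i ->]]; exists (w * s i)%g, i.
by rewrite (geom_act_mul cox) (geom_act_gen cox) reflection_alpha /geom_act mulmxN.
Qed.

Definition inversions (w : W) : set 'cV[R]_n :=
  [set v | [/\ root v, nonneg v & ~ nonneg (rho w *m v)]].

(** A simple reflection changes only coordinate [i], so a positive root made negative is a multiple
    of [a i]; norm 1 fixes the multiple. *)
Lemma inversions_gen i : inversions (s i) `<=` [set a i].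
Proof.
move=> v [vroot v0 /=]; rewrite geom_rep_gen // => nsv.
have := root_sign (root_geom_rep (s i) vroot); rewrite geom_rep_gen // => -[//|sv0].
have vE : v = v i 0 *: a i.
  apply/matrixP => j k; rewrite (ord1 k) !mxE andbT.
  have [->|ji] := eqVneq j i; first by rewrite mulr1.
  have := sv0 j; rewrite /reflection !mxE andbT (negbTE ji) !mulr0 subr0 oppr_ge0.
  by have := v0 j; lra.
have := root_norm vroot; rewrite vE bformZl // bformZr bformE (gram_diag R cox) mulr1.
have := v0 i; move: (v i 0) => c c0 /eqP; rewrite -expr2 sqrf_eq1.
by case/orP => /eqP cE; [rewrite cE scale1r | rewrite cE oppr_ge0 ler10 in c0].
Qed.

(** An inversion of [x * y] is one of [y] or is carried by [y] to one of [x]. The inversions of the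
    inverse of [x] are among the vectors [- (rho x *m v)], with [v] an inversion of [x]. *)
Lemma inversions_finite w : finite_set (inversions w).
Proof.
case: (cox) => _ _ gen _.
suff /seteqP[_ /(_ w)] : [set w | finite_set (inversions w)] = setT by apply.
apply: gen => /= [|x y finx finy|x finx|i].
- apply: sub_finite_set (finite_set0 _) => v [_ v0].
  by rewrite geom_rep1 // mul1mx.
- apply: (@sub_finite_set _ _ (inversions y `|`
      (fun v => rho y^-1%g *m v) @` inversions x)); last first.
    by rewrite finite_setU; split=> //; exact: finite_image.
  move=> v [vroot v0]; rewrite geom_repM // -mulmxA => nxyv.
  have [yv0|] := pselect (nonneg (rho y *m v)); last by left.
  right; exists (rho y *m v); last by rewrite geom_repK.
  by split=> //; exact: root_geom_rep.
- apply: (@sub_finite_set _ _ ((fun v => - (rho x *m v)) @` inversions x)).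
    move=> v [vroot v0 nxv]; exists (- (rho x^-1%g *m v)); last first.
      by rewrite mulmxN geom_repVK // opprK.
    have vroot' := root_geom_rep x^-1%g vroot.
    split; [exact: root_opp | by case: (root_sign vroot') |].
    rewrite mulmxN geom_repVK // => nv0; have /eqP[] := root_neq0 vroot.
    apply/matrixP => j k; rewrite (ord1 k) mxE; apply/eqP; rewrite eq_le v0.
    by have := nv0 j; rewrite mxE oppr_ge0 => ->.
  exact: finite_image.
- exact: sub_finite_set (@inversions_gen i) (finite_set1 _).
Qed.

Lemma pairing_alpha (f : 'rV[R]_n) i : pairing f (a i) = f 0 i.
Proof. by rewrite /pairing /alpha -colE mxE. Qed.

Lemma pairingBr (f : 'rV[R]_n) u v : pairing f (u - v) = pairing f u - pairing f v.
Proof. by rewrite /pairing mulmxBr !mxE. Qed.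

Lemma pairingZr (f : 'rV[R]_n) c v : pairing f (c *: v) = c * pairing f v.
Proof. by rewrite /pairing -scalemxAr mxE. Qed.

Lemma closure_chamber_ge0 (f : 'rV[R]_n) :
  closure (@chamber R n) f -> forall i, 0 <= f 0 i.
Proof.
move=> fC i; have : closed [set g : 'rV[R]_n | 0 <= g 0 i].
  apply: (@closed_comp _ _ (fun g : 'rV[R]_n => g 0 i) [set x | 0 <= x]).
    by move=> g _; exact: coord_continuous.
  exact: closed_ge.
move/closure_id => cE; suff : [set g : 'rV[R]_n | 0 <= g 0 i] f by [].
rewrite cE; apply: closureS fC => g gC /=.
by rewrite -pairing_alpha ltW.
Qed.

(** Write [f] as the image under [w] of a point [g] of the closed chamber. As [g] is nonnegative on
    nonnegative vectors, the positive roots negative at [f] are inversions of the inverse of [w]. *)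
Lemma tits_cone_neg_roots (f : 'rV[R]_n) : tits_cone s f ->
  finite_set [set v | [/\ root v, nonneg v & pairing f v < 0]].
Proof.
move=> [w _ [g /closure_chamber_ge0 g0 <-]].
apply: sub_finite_set (inversions_finite w^-1%g) => v [vroot v0 fv]; split=> //.
move=> wv0; move: fv; apply/negP; rewrite -leNgt /pairing /dual_act -mulmxA mxE.
by apply: sumr_ge0 => i _; rewrite mulr_ge0.
Qed.

(** Lowering all coordinates of [f] by a small constant stays in the cone and makes every positive
    root that vanishes at [f] negative; [tits_cone_neg_roots] applies there. Negative roots are
    opposites of these. *)
Lemma tits_interior_zero_roots (f : 'rV[R]_n) : (tits_cone s)° f ->
  finite_set [set v | root v /\ pairing f v = 0].
Proof.
move=> /nbhs_ballP[e /= e0 feU].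
pose g := f - const_mx (e / 2).
have gU : tits_cone s g.
  apply: feU; split=> // i j; rewrite /g /ball /= !mxE opprB addrC subrK gtr0_norm; lra.
pose Z := [set v | [/\ root v, nonneg v & pairing g v < 0]].
have Zfin : finite_set Z := tits_cone_neg_roots gU.
have ZE v : root v -> nonneg v -> pairing f v = 0 -> Z v.
  move=> vroot v0 fv; split=> //; rewrite /pairing mulmxBl mxE.
  rewrite -[(f *m v) 0 0]/(pairing f v) fv add0r !mxE oppr_lt0.
  have F0 i : true -> 0 <= (const_mx (e / 2) : 'rV[R]_n) 0 i * v i 0.
    by rewrite mxE mulr_ge0 // ltW // divr_gt0.
  rewrite lt_neqAle; apply/andP; split; last exact: sumr_ge0.
  apply/eqP => /esym/(psumr_eq0P F0) vE.
  have /eqP[] := root_neq0 vroot; apply/matrixP => i j; rewrite (ord1 j) [RHS]mxE.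
  move/eqP: (vE i isT); rewrite mxE mulf_eq0 => /orP[/eqP e2|/eqP //]; lra.
apply: (@sub_finite_set _ _ (Z `|` -%R @` Z)).
  move=> v [vroot fv]; have [v0|v0] := root_sign vroot; first by left; exact: ZE.
  right; exists (- v); last exact: opprK.
  by apply: ZE => //; [exact: root_opp | rewrite -scaleN1r pairingZr fv mulr0].
by rewrite finite_setU; split=> //; exact: finite_image.
Qed.

(** The powers of [r1 * r2] keep the root [v] among the finitely many roots vanishing at [f], so
    some positive power [x] fixes [v]. Preserving the form, [x] acts as a map commuting with the
    reflection [r1] in [v]. *)
Lemma wall_product_finite_order (f : 'rV[R]_n) w1 i1 w2 i2 :
  (tits_cone s)° f ->
  pairing f (rho w1 *m a i1) = 0 -> pairing f (rho w2 *m a i2) = 0 ->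
  let r1 := (w1 * s i1 * w1^-1)%g in let r2 := (w2 * s i2 * w2^-1)%g in
  exists2 m, (0 < m)%N & rho ((r1 * r2) ^+ m)%g = 1%:M.
Proof.
move=> fU f1 f2 r1 r2; set v := rho w1 *m a i1 in f1.
have rr w i : ((w * s i * w^-1) * (w * s i * w^-1) = 1)%g.
  by rewrite -!mulgA mulKg [(s i * (s i * _))%g]mulgA (coxeter_sq cox) mul1g mulgV.
have vroot : root v by exists w1, i1.
have fr w i (u : 'cV[R]_n) : pairing f (rho w *m a i) = 0 -> pairing f u = 0 ->
    pairing f (rho (w * s i * w^-1)%g *m u) = 0.
  by move=> fw fu; rewrite geom_rep_reflection // pairingBr pairingZr fw fu mulr0 subr0.
have fr1 u : pairing f u = 0 -> pairing f (rho r1 *m u) = 0 by exact: fr.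
have fr2 u : pairing f u = 0 -> pairing f (rho r2 *m u) = 0 by exact: fr.
have r1r1 : (r1 * r1 = 1)%g by exact: rr.
have r2r2 : (r2 * r2 = 1)%g by exact: rr.
have r1E u : rho r1 *m u = u - (2 * B v u) *: v by exact: geom_rep_reflection.
clearbody r1 r2 => {fr rr}.
have orbit k : root (rho ((r1 * r2) ^+ k)%g *m v) /\
    pairing f (rho ((r1 * r2) ^+ k)%g *m v) = 0.
  split; first exact: root_geom_rep.
  elim: k => [|k IH]; first by rewrite expg0 geom_rep1 // mul1mx.
  by rewrite expgS !geom_repM // -!mulmxA; apply/fr1/fr2.
have [k [l [kl gkl]]] := finite_set_recurrent (tits_interior_zero_roots fU) orbit.
pose x := ((r1 * r2) ^+ (l - k))%g.
have xv : rho x *m v = v.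
  rewrite -[LHS](geom_repK cox ((r1 * r2) ^+ k)%g) -[RHS](geom_repK cox ((r1 * r2) ^+ k)%g).
  by rewrite (mulmxA (rho ((r1 * r2) ^+ k)%g)) -geom_repM // -expgnDr subnKC ?gkl // ltnW.
have comm : rho (x * r1)%g = rho (r1 * x)%g.
  apply: mulmx_cV_inj => u; rewrite !geom_repM // -!mulmxA !r1E mulmxBr.
  by rewrite -scalemxAr xv -(bform_geom_rep cox x v u) xv.
(* Conjugation by [r1] also inverts [x], so [rho x] is its own inverse; hence the doubled
   exponent. *)
exists (l - k + (l - k))%N; first by rewrite addn_gt0 subn_gt0 kl.
rewrite expgnDr -/x -[X in (X * _)%g](mulgK r1) -mulgA.
have r1V : (r1^-1 = r1)%g by apply: (@mulgI _ r1); rewrite mulgV.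
rewrite r1V geom_repM // comm -geom_repM // mulgA involutions_conjX // mulVg geom_rep1 //.
Qed.

End Walls.

(** * Finiteness of Z[x] modulo 3 and integrality of 2 cos (pi / N) *)

Lemma int_adjoin_mod3_finite (R : numFieldType) (x : R) :
  integralOver (intr : int -> R) x ->
  exists (F : finType) (chi : R -> F), forall y z,
    int_adjoin x y -> int_adjoin x z -> chi y = chi z -> cong3 x y z.
Proof.
move=> [q qmon /eqP qx].
(* Division by the monic [q], which vanishes at [x], bounds the degree; coefficients modulo 3 then
   leave finitely many codes. *)
pose red (p : {poly int}) := Pdiv.Ring.rmodp p q.
have redE p : (map_poly intr p).[x] = (map_poly intr (red p)).[x] :> R.
  rewrite {1}(Pdiv.RingMonic.rdivp_eq qmon p) rmorphD rmorphM.
  by rewrite hornerD hornerM qx mulr0 add0r.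
have redsz p : (size (red p) <= size q)%N.
  by rewrite ltnW // Pdiv.Ring.ltn_rmodpN0 // monic_neq0.
pose code (p : {poly int}) : {ffun 'I_(size q) -> 'I_3} :=
  [ffun i : 'I_(size q) => inord `|((red p)`_i %% 3)%Z|%N].
have codeP p1 p2 : code p1 = code p2 ->
    exists u : {poly int}, red p1 = red p2 + u *+ 3.
  move=> /ffunP E; exists (\poly_(i < size q) (((red p1)`_i - (red p2)`_i) %/ 3)%Z).
  apply/polyP => i; rewrite coefD coefMn coef_poly.
  have [iq|qi] := ltnP i (size q); last first.
    by rewrite !nth_default ?(leq_trans (redsz _)).
  have := E (Ordinal iq); rewrite !ffunE /= => /(congr1 (@nat_of_ord 3)).
  have lt3 (k : int) : (`|(k %% 3)%Z| < 3)%N by lia.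
  rewrite !inordK // -mulr_natr => kE; lia.
(* Several polynomials may have the value [y] at [x], so one is chosen; outside Z[x] the colour is a
   dummy. *)
pose chi (y : R) : {ffun 'I_(size q) -> 'I_3} :=
  if pselect (int_adjoin x y) is left h then code (sval (cid h)) else [ffun=> ord0].
exists _, chi => y z yx zx; rewrite /chi.
case: pselect => // hy; case: pselect => // hz.
case: (cid hy) (cid hz) => [p /= pE] [p' /= p'E] /codeP[u uE].
split=> //; exists (map_poly intr u).[x]; first by exists u.
by rewrite pE p'E redE uE rmorphD rmorphMn hornerD hornerMn -redE.
Qed.

(* Chebyshev polynomials, normalized to be monic. *)
Fixpoint cheb (k : nat) : {poly int} :=
  if k is k'.+1 then
    if k' is k''.+1 then 'X * cheb k' - cheb k'' else 'X
  else 2%:P.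

Lemma cheb_cos (R : realType) (t : R) k :
  (map_poly intr (cheb k)).[2 * cos t] = 2 * cos (t *+ k).
Proof.
suff : (map_poly intr (cheb k)).[2 * cos t] = 2 * cos (t *+ k) /\
  (map_poly intr (cheb k.+1)).[2 * cos t] = 2 * cos (t *+ k.+1) by case.
elim: k => [|k [IH1 IH2]].
  by rewrite /= map_polyC hornerC map_polyX hornerX mulr0n cos0 mulr1n mulr1.
split=> //; rewrite [cheb _]/= -/(cheb k.+1) rmorphB rmorphM /= map_polyX.
rewrite hornerD hornerN hornerM hornerX -/(cheb k.+1) IH1 IH2.
set u := t *+ k.+1.
have -> : t *+ k.+2 = u + t by rewrite mulrSr.
have -> : t *+ k = u - t by rewrite /u mulrSr addrK.
rewrite cosB cosD; ring.
Qed.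

Lemma cheb_monic k : cheb k.+1 \is monic /\ size (cheb k.+1) = k.+2.
Proof.
suff : [/\ cheb k.+1 \is monic, size (cheb k.+1) = k.+2 & (size (cheb k) < k.+2)%N].
  by case.
elim: k => [|k [mon sz sz']].
  by rewrite /= monicX size_polyX size_polyC.
have szX : size ('X * cheb k.+1) = k.+3 by rewrite mulrC size_mulX ?monic_neq0 // sz.
have lt : (size (- cheb k)%R < size ('X * cheb k.+1)%R)%N by rewrite size_polyN szX ltnW.
rewrite [cheb k.+2]/= -/(cheb k.+1); split; last by rewrite sz.
  by rewrite monicE lead_coefDl // mulrC lead_coefMX -monicE.
by rewrite size_polyDl.
Qed.

(** At this point [cheb N] takes the value [2 * cos pi], so [cheb N + 2] is a monic polynomial
    vanishing there. *)
Lemma integral_2cos (R : realType) (N : nat) : (0 < N)%N ->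
  integralOver (intr : int -> R) (2 * cos (pi / N%:R)).
Proof.
case: N => // N _; have [mon sz] := cheb_monic N.
have sz2 : (size (2%:P : {poly int}) < size (cheb N.+1))%N.
  by rewrite sz size_polyC.
exists (cheb N.+1 + 2%:P); first by rewrite monicE lead_coefDl // -monicE.
rewrite /root rmorphD hornerD cheb_cos /= map_polyC hornerC.
have -> : pi / N.+1%:R *+ N.+1 = pi :> R by rewrite -mulr_natr divfK // pnatr_eq0.
by rewrite cospi mulrN1 addNr.
Qed.

(** * Walls whose reflections agree modulo 3 *)

Section Colouring.
Variables (R : realType) (W : groupType) (n : nat) (s : 'I_n -> W).
Hypothesis cox : coxeter_system s.

Local Notation rho := (geom_rep R s).
Local Notation a := (alpha R).

(** With [N] a common multiple of the finite orders, each [pi / m] is a multiple [k] of [pi / N],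
    and [cheb k] expresses its doubled cosine. *)
Lemma gram_int_adjoin : exists2 x : R, integralOver (intr : int -> R) x &
  forall i j, int_adjoin x (2 * gram R s i j).
Proof.
pose m i j := gorder (s i * s j)%g.
(* Infinite order, encoded by 0, is replaced by 1 to keep [N] positive. *)
pose m' i j := if m i j == 0%N then 1%N else m i j.
pose N := (\prod_i \prod_j m' i j)%N.
have m'0 i j : (0 < m' i j)%N by rewrite /m'; case: eqP => // /eqP; rewrite lt0n.
exists (2 * cos (pi / N%:R)).
  by apply: integral_2cos; do 2 apply: prodn_gt0 => ?.
move=> i j; rewrite mxE /= -/(m i j).
have [_|mij] := eqVneq; first by rewrite mulrN1; exact: (int_adjoin_int _ (-2)).
rewrite mulrN; apply: int_adjoinN.
have /dvdnP[k kE] : (m i j %| N)%N.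
  rewrite /N (bigD1 i) //= (bigD1 j) //= /m' (negbTE mij) -mulnA.
  exact: dvdn_mulr.
exists (cheb k); rewrite cheb_cos; congr (2 * cos _).
have N0 : N%:R != 0 :> R by rewrite pnatr_eq0 -lt0n; do 2 apply: prodn_gt0 => ?.
have m0 : (m i j)%:R != 0 :> R by rewrite pnatr_eq0.
by rewrite -[_ *+ k]mulr_natr; apply: (mulIf m0); rewrite divfK // -[RHS]mulrA -natrM -kE divfK.
Qed.

Lemma geom_rep_int_adjoin x : (forall i j, int_adjoin x (2 * gram R s i j)) ->
  forall w, mx_adjoin x (rho w).
Proof.
move=> gx w; case: (wprod_surj cox w) => l <-{w}.
elim: l => [|i l IH] /=; first by rewrite geom_rep1 //; exact: mx_adjoin1.
rewrite geom_repM //; apply: mx_adjoinM => // j k.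
have -> : rho (s i) j k = (rho (s i) *m a k) j 0 by rewrite /alpha -colE mxE.
rewrite geom_rep_gen // /reflection bformE !mxE.
apply: int_adjoinD; first exact: int_adjoin_nat.
apply/int_adjoinN/int_adjoinM; last exact: int_adjoin_nat.
by have := gx i k; rewrite mxE.
Qed.

(** Evaluating both reflections at the second root [v], which has norm 1, shows that [v] is a
    multiple of the first root [u]. *)
Lemma reflection_hyperplane w1 i1 w2 i2 :
  rho (w1 * s i1 * w1^-1)%g = rho (w2 * s i2 * w2^-1)%g ->
  hyperplane (rho w1 *m a i1) = hyperplane (rho w2 *m a i2).
Proof.
wlog suff sub : w1 i1 w2 i2 / rho (w1 * s i1 * w1^-1)%g = rho (w2 * s i2 * w2^-1)%g ->
  hyperplane (rho w1 *m a i1) `<=` hyperplane (rho w2 *m a i2).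
  by move=> E; apply/seteqP; split; exact: sub.
move=> E f f1; set u := rho w1 *m a i1 in f1; set v := rho w2 *m a i2.
have vroot : coxeter_root s v by exists w2, i2.
have := congr1 (mulmx^~ v) E; rewrite !geom_rep_reflection // -/u -/v (root_norm cox vroot).
move=> /addrI /oppr_inj /(congr1 (pairing f)); rewrite !pairingZr f1 mulr0 mulr1.
by move=> /esym/eqP; rewrite mulf_eq0 pnatr_eq0 /= => /eqP.
Qed.

(** From [rho r1 = rho r2 + D *+ 3] and [r2 * r2 = 1] follows
    [rho (r1 * r2) = 1 + (D * rho r2) *+ 3]. This has finite order, so [torsion_cong3] gives
    [D * rho r2 = 0], hence [D = 0]. *)
Lemma same_colour x w1 i1 w2 i2 (f : 'rV[R]_n) :
  integralOver (intr : int -> R) x ->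
  (forall i j, int_adjoin x (2 * gram R s i j)) ->
  (tits_cone s)° f ->
  hyperplane (rho w1 *m a i1) f -> hyperplane (rho w2 *m a i2) f ->
  (forall i j, cong3 x (rho (w1 * s i1 * w1^-1)%g i j) (rho (w2 * s i2 * w2^-1)%g i j)) ->
  hyperplane (rho w1 *m a i1) = hyperplane (rho w2 *m a i2).
Proof.
move=> xint gx fU f1 f2 E; apply: reflection_hyperplane.
have [m m0] := wall_product_finite_order cox fU f1 f2.
set r1 := (w1 * _ * _)%g in E *; set r2 := (w2 * _ * _)%g in E *.
have r2r2 : (r2 * r2 = 1)%g.
  by rewrite /r2 -!mulgA mulKg [(s i2 * (s i2 * _))%g]mulgA (coxeter_sq cox) mul1g mulgV.
clearbody r1 r2 => {f1 f2} gm.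
have rhoX g k : rho (g ^+ k)%g = rho g ^+ k.
  by elim: k => [|k IH]; [rewrite expg0 geom_rep1 | rewrite expgS exprS geom_repM // IH].
have [D Dx DE] : exists2 D, mx_adjoin x D & rho r1 = rho r2 + D *+ 3.
  have /choice[D DP] (ij : 'I_n * 'I_n) : exists u, int_adjoin x u /\
      rho r1 ij.1 ij.2 = rho r2 ij.1 ij.2 + u *+ 3.
    by have [_ _ [u ux uE]] := E ij.1 ij.2; exists u.
  exists (\matrix_(i, j) D (i, j)) => [i j|].
    by rewrite mxE; case: (DP (i, j)).
  by apply/matrixP => i j; rewrite !(mxE, mulmxnE); case: (DP (i, j)).
have gE : rho (r1 * r2)%g = 1 + (D * rho r2) *+ 3.
  by rewrite geom_repM // DE mulmxDl -geom_repM // r2r2 geom_rep1 // -mulrnAl.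
have : D * rho r2 = 0.
  apply: (torsion_cong3 xint m0); last by rewrite -gE -rhoX.
  by apply: mx_adjoinM => //; exact: geom_rep_int_adjoin.
move=> /(congr1 (mulmx^~ (rho r2))); rewrite -mulmxA -geom_repM // r2r2 geom_rep1 // mulmx1 mul0mx.
by rewrite DE => ->; rewrite mul0rn addr0.
Qed.

End Colouring.

(** * Counting walls by colours *)

Theorem theorem1p5 (R : realType) (W : groupType) (n : nat) (s : 'I_n -> W) :
  coxeter_system s ->
  exists M : nat,
    forall Q : set (set 'rV[R]_n), intersecting s Q -> (Q #<= `I_M)%card.
Proof.
move=> cox; have [x xint gx] := gram_int_adjoin R s.
have [F [chi chiP]] := int_adjoin_mod3_finite xint.
pose col (w : W) : {ffun 'I_n * 'I_n -> F} := [ffun ij => chi (geom_rep R s w ij.1 ij.2)].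
exists #|{ffun 'I_n * 'I_n -> F}| => Q [Qwalls Qmeet].
(* A list instead of an index, so that a default value exists when [n = 0]. *)
have /choice[wi wiP] (H : set 'rV[R]_n) : exists wi : W * seq 'I_n, Q H ->
    exists2 i, wi.2 = [:: i] & H = hyperplane (geom_rep R s wi.1 *m alpha R i).
  have [QH|nQH] := pselect (Q H); last by exists (1%g, [::]).
  by have [_ [[w [i ->]] _] <-] := Qwalls _ QH; exists (w, [:: i]) => _; exists i.
(* On [Q] the list has one letter, so this is the reflection in the chosen root of [H]. *)
pose refl (H : set 'rV[R]_n) : W := let: (w, l) := wi H in (w * wprod s l * w^-1)%g.
have inj : {in Q &, injective (fun H => enum_rank (col (refl H)) : nat)}.
  move=> H1 H2 /set_mem Q1 /set_mem Q2 /ord_inj/enum_rank_inj.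
  have [f [[f1 f2] fU]] := Qmeet _ _ Q1 Q2.
  rewrite /refl; case: (wi H1) (wi H2) (wiP _ Q1) (wiP _ Q2) => [w1 l1] [w2 l2] /=.
  move=> [i1 -> H1E] [i2 -> H2E] /=; rewrite !mulg1 => /ffunP E.
  rewrite H1E H2E in f1 f2 *; apply: (same_colour cox xint gx fU f1 f2) => i j.
  have := E (i, j); rewrite !ffunE /=; apply: chiP; exact: geom_rep_int_adjoin.
rewrite -(card_le_eql (inj_card_eq inj)).
by apply: subset_card_le => _ [H _ <-] /=.
Qed.
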